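(* Let $N$ be a non-negative integer and let $\alpha,\beta$ be real parameters. For $n=0,1,\dots,N$ the polynomials $$P_n(x)={}_3F_2\left({-n,\,-x,\,\alpha+1 \atop -N,\,1-\beta-n};1\right)$$ on the grid $x=0,1,\dots,N$ satisfy the three-term recurrence relation $$\mathcal{A}_n P_{n+1}(x)-(\mathcal{A}_n+\mathcal{B}_n)P_n(x)+\mathcal{B}_n P_{n-1}(x)=-x\left((n+\alpha+1)P_n(x)+\frac{n(\alpha+\beta+n)}{1-\beta-n}P_{n-1}(x)\right),$$ where $\mathcal{A}_n=(n-N)(\beta+n)$ and $\mathcal{B}_n=n(\alpha+\beta+n)$.
   Context: Here ${}_3F_2$ is the standard hypergeometric function; with $(a)_0=1$, $(a)_k=a(a+1)\cdots(a+k-1)$ the Pochhammer symbol, the terminating series is the finite sum $$P_n(x)=\sum_{k=0}^{n}\frac{(-n)_k(-x)_k(\alpha+1)_k}{k!\,(-N)_k(1-\beta-n)_k}.$$ The coefficient $\mathcal{A}_N$ of $P_{N+1}$ is zero, as are the coefficients of $P_{-1}$ at $n=0$, so these terms are absent. *)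

(* Defs.v *)
From mathcomp Require Import all_boot all_order all_algebra.
From mathcomp Require Import reals.

Set Implicit Arguments.
Unset Strict Implicit.
Unset Printing Implicit Defensive.

Import Order.TTheory GRing.Theory Num.Theory.
Local Open Scope ring_scope.

Definition pochhammer (R : realType) (a : R) (k : nat) : R :=
  \prod_(j < k) (a + j%:R).

(* The terminating series 3F2(a, b, c; d, e; z), summed over k = 0, ..., n.
   It is meant for a = - n, so that the terms k > n vanish formally; the
   explicit cut-off is needed because the lower parameter d = - N is itself a
   nonpositive integer.  The series is well defined when (d)_k and (e)_k are
   nonzero for all k <= n. *)
Definition hyp3F2 (R : realType) (n : nat) (a b c d e z : R) : R :=
  \sum_(k < n.+1)
    (pochhammer a k * pochhammer b k * pochhammer c k)
    / (k`!%:R * pochhammer d k * pochhammer e k) * z ^+ k.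

Definition Pn (R : realType) (N : nat) (alpha beta : R) (n : nat) (x : R) : R :=
  hyp3F2 n (- n%:R) (- x) (alpha + 1) (- N%:R) (1 - beta - n%:R) 1.

Definition recA (R : realType) (N : nat) (beta : R) (n : nat) : R :=
  (n%:R - N%:R) * (beta + n%:R).

Definition recB (R : realType) (alpha beta : R) (n : nat) : R :=
  n%:R * (alpha + beta + n%:R).

(* Main.v *)
Require Import Defs.
From mathcomp Require Import all_boot all_order all_algebra.
From mathcomp Require Import reals.
From mathcomp Require Import ring lra.
Import Order.TTheory GRing.Theory Num.Theory.
Local Open Scope ring_scope.

(** Expand [P_n = \sum_k d_(n,k) psi_k] in [psi_k = (-x)_k / (k! (-N)_k)], with
    [d_(n,k) = (alpha+1)_k (-n)_k / (1-beta-n)_k].  Multiplication by [x] is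
    bidiagonal in this basis,
      [- x psi_k = - k psi_k + (k+1)(k-N) psi_(k+1)],
    so the recurrence reduces to an identity between the coefficients
    [d_(n+1,k), d_(n,k), d_(n-1,k), d_(n,k-1), d_(n-1,k-1)], each of which is a
    rational multiple of [(alpha+1)_(k-1) (-n)_(k-1) / (1-beta-n)_(k-1)]. *)

Lemma pochhammer0 (R : realType) (a : R) : pochhammer a 0 = 1.
Proof. by rewrite /pochhammer big_ord0. Qed.

Lemma pochhammerSr (R : realType) (a : R) k :
  pochhammer a k.+1 = pochhammer a k * (a + k%:R).
Proof. by rewrite /pochhammer big_ord_recr. Qed.

Lemma pochhammerSl (R : realType) (a : R) k :
  pochhammer a k.+1 = a * pochhammer (a + 1) k.
Proof.
rewrite /pochhammer big_ord_recl addr0; congr (_ * _).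
by apply: eq_bigr => j _; rewrite /= /bump leq0n natrD addrA.
Qed.

Lemma pochhammer_shift (R : realType) (a : R) k :
  a * pochhammer (a + 1) k = pochhammer a k * (a + k%:R).
Proof. by rewrite -pochhammerSl pochhammerSr. Qed.

Lemma pochhammer_oppn_eq0 (R : realType) (n k : nat) :
  (pochhammer (- n%:R : R) k == 0) = (n < k)%N.
Proof.
apply/idP/idP => [/prodf_eq0[j _]|ltnk].
  by rewrite addrC subr_eq0 eqr_nat => /eqP <-.
by apply/prodf_eq0; exists (Ordinal ltnk); rewrite //= addNr.
Qed.

Definition gridBasis {R : realType} (N : nat) (x : R) (k : nat) : R :=
  pochhammer (- x) k / (k`!%:R * pochhammer (- N%:R) k).

Definition gridCoef {R : realType} (alpha beta : R) (n k : nat) : R :=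
  pochhammer (alpha + 1) k * pochhammer (- n%:R) k
  / pochhammer (1 - beta - n%:R) k.

Lemma gridCoef_eq0 {R : realType} (alpha beta : R) n k :
  (n < k)%N -> gridCoef alpha beta n k = 0.
Proof.
by rewrite -(pochhammer_oppn_eq0 R) /gridCoef => /eqP ->; rewrite mulr0 mul0r.
Qed.

Lemma gridCoef0 (R : realType) (alpha beta : R) n : gridCoef alpha beta n 0 = 1.
Proof. by rewrite /gridCoef !pochhammer0 divr1 mulr1. Qed.

(** Padding to any length [m] gives the three polynomials one summation range. The added terms
    vanish through the numerator factor (-n)_k, whatever the denominators are. *)
Lemma PnE (R : realType) (N : nat) (alpha beta : R) n m (x : R) :
  (n < m)%N ->
  Pn N alpha beta n x
  = \sum_(k < m) gridCoef alpha beta n k * gridBasis N x k.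
Proof.
move=> ltnm; rewrite /Pn /hyp3F2.
transitivity (\sum_(k < n.+1) gridCoef alpha beta n k * gridBasis N x k).
  apply: eq_bigr => k _; rewrite expr1n /gridCoef /gridBasis !invfM.
  by ring.
rewrite (big_ord_widen m
  (fun k => gridCoef alpha beta n k * gridBasis N x k)) //.
rewrite big_mkcond; apply: eq_bigr => k _; case: ltnP => // /gridCoef_eq0 ->.
by rewrite mul0r.
Qed.

Lemma mulNx_gridBasis (R : realType) (N x k : nat) : (x <= N)%N ->
  - x%:R * gridBasis N (x%:R : R) k
  = - k%:R * gridBasis N x%:R k
    + k.+1%:R * (k%:R - N%:R) * gridBasis N x%:R k.+1.
Proof.
move=> lexN; rewrite /gridBasis.
(* For k >= N the denominator (-N)_(k+1) is zero; there x <= N <= k gives (-x)_(k+1) = 0, so both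
   sides agree. *)
case: (ltnP k N) => [ltkN | leNk]; last first.
  have /eqP H : pochhammer (- x%:R : R) k.+1 == 0.
    by rewrite pochhammer_oppn_eq0 ltnS (leq_trans lexN).
  rewrite H mul0r mulr0 addr0; apply/eqP; rewrite -subr_eq0 -mulrBl opprK.
  by rewrite mulrA [(_ + _) * _]mulrC -pochhammerSr H mul0r.
have fk : (k`!%:R : R) != 0 by rewrite pnatr_eq0 -lt0n fact_gt0.
have hk : pochhammer (- N%:R : R) k != 0.
  by rewrite pochhammer_oppn_eq0 -leqNgt ltnW.
have hN : - N%:R + k%:R != 0 :> R.
  by rewrite addrC subr_eq0 eqr_nat neq_ltn ltkN.
have hS : 1 + k%:R != 0 :> R by rewrite nat1r pnatr_eq0.
rewrite !pochhammerSr factS natrM -natr1.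
by field; rewrite fk hk hN addrC hS.
Qed.

(** Compares the coefficients of psi_(k+1): [e] expands the bracket on the right, and multiplication
    by x brings only [e k.+1] and [e k] into this degree. *)
Lemma gridCoef_recurrence (R : realType) (N : nat) (alpha beta : R)
    (Hwd : forall m k : nat, (k <= m)%N -> (m <= N)%N ->
       pochhammer (1 - beta - m%:R) k != 0) (n k : nat) :
  let e j := (n%:R + alpha + 1) * gridCoef alpha beta n j
    + n%:R * (alpha + beta + n%:R) / (1 - beta - n%:R)
      * gridCoef alpha beta n.-1 j in
  (n <= N)%N -> (k <= n)%N ->
  recA N beta n * gridCoef alpha beta n.+1 k.+1
  - (recA N beta n + recB alpha beta n) * gridCoef alpha beta n k.+1
  + recB alpha beta n * gridCoef alpha beta n.-1 k.+1
  = - k.+1%:R * e k.+1 + k.+1%:R * (k%:R - N%:R) * e k.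
Proof.
move=> e lenN lekn.
have w0 := Hwd n k lekn lenN.
(* The factor [beta + n] of [recA] cancels the leading factor of
   [(- beta - n)_k.+1], which may vanish when [n = N]; then [recA] is 0. *)
have AE : recA N beta n * gridCoef alpha beta n.+1 k.+1
    = (n%:R - N%:R) * (n%:R + 1) * (pochhammer (alpha + 1) k
      * (alpha + 1 + k%:R)) * pochhammer (- n%:R) k
      / pochhammer (1 - beta - n%:R) k.
  rewrite /recA /gridCoef; case: (ltnP n N) => [ltnN | leNn]; last first.
    have -> : n = N by apply/eqP; rewrite eqn_leq lenN.
    by rewrite subrr !mul0r.
  have u1 : 1 - beta - n.+1%:R != 0.
    by have := Hwd n.+1 1%N isT ltnN; rewrite pochhammerSl pochhammer0 mulr1.
  rewrite (pochhammerSl _ (1 - _ - _)) (pochhammerSl _ (- n.+1%:R)).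
  rewrite pochhammerSr.
  have -> : 1 - beta - n.+1%:R + 1 = 1 - beta - n%:R by rewrite -natr1; ring.
  have -> : - n.+1%:R + 1 = - n%:R :> R by rewrite -natr1; ring.
  move: u1; rewrite -natr1 => u1.
  field; rewrite w0 /=; apply: contraNneq u1 => H; apply/eqP; lra.
rewrite {}AE.
case: n => [|n] in e lenN lekn w0 *.
  move: lekn; rewrite leqn0 => /eqP ->.
  rewrite /e /recB gridCoef0 !gridCoef_eq0 // !pochhammer0.
  by rewrite !mul0r divr1; ring.
have u0 : 1 - beta - n.+1%:R != 0.
  by have := Hwd n.+1 1%N isT lenN; rewrite pochhammerSl pochhammer0 mulr1.
have n0 : - n.+1%:R != 0 :> R by rewrite oppr_eq0 pnatr_eq0.
have shift a : a - n%:R = a - n.+1%:R + 1 :> R by rewrite -natr1; ring.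
(* Going down one degree raises -n and 1-beta-n by one; this rewrites the shifted symbols over the
   unshifted ones. *)
have pe b : b != 0 -> forall j, pochhammer (b + 1) j
    = pochhammer b j * (b + j%:R) / b :> R.
  by move=> b0 j; rewrite -pochhammer_shift mulrC mulKf.
have numE j : pochhammer (- n%:R : R) j
    = pochhammer (- n.+1%:R) j * (- n.+1%:R + j%:R) / - n.+1%:R.
  by rewrite -pe // -sub0r shift sub0r.
have denE j : pochhammer (1 - beta - n%:R) j
    = pochhammer (1 - beta - n.+1%:R) j * (1 - beta - n.+1%:R + j%:R)
      / (1 - beta - n.+1%:R).
  by rewrite -pe // shift.
have den_neq0 j : (j < n.+1)%N -> 1 - beta - n.+1%:R + j%:R != 0.
  move=> ltj; have := Hwd n.+1 j.+1 ltj lenN.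
  by rewrite pochhammerSr mulf_eq0 => /norP[].
rewrite {}/e /recA /recB /=.
(* The two top values of k are separate: there the coefficients past the degree are zero, while
   clearing their denominators would need 1 - beta to be nonzero, which [Hwd] does not give. *)
move: lekn; rewrite leq_eqVlt => /orP[/eqP Ek | ltkn].
  rewrite Ek in w0 *; rewrite !(gridCoef_eq0 alpha beta _ n.+2) //.
  rewrite !(gridCoef_eq0 alpha beta n n.+1) // /gridCoef.
  by rewrite -natr1 -[n.+2%:R]natr1 -natr1 in w0 u0 *; field; rewrite w0 u0.
have uk := den_neq0 k ltkn.
move: ltkn; rewrite ltnS leq_eqVlt => /orP[/eqP Ek | ltkn].
  rewrite (gridCoef_eq0 alpha beta n k.+1) ?Ek //.
  rewrite -Ek in n0 u0 w0 uk numE denE *.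
  rewrite /gridCoef !numE !denE !pochhammerSr.
  rewrite -natr1 in n0 u0 w0 uk *.
  by field; rewrite u0 uk w0 -oppr_eq0.
have uk1 := den_neq0 k.+1 ltkn.
rewrite /gridCoef !numE !denE !pochhammerSr.
rewrite -!natr1 in n0 u0 w0 uk uk1 *.
by field; rewrite u0 uk w0 uk1 andbT -oppr_eq0.
Qed.

(* Hwd says that every P_m, 0 <= m <= N, is well defined: no denominator
   (1 - beta - m)_k of its series vanishes (the factors (- N)_k are nonzero
   since k <= m <= N).
   At n = N the term P_{N+1} has coefficient recA N beta N = 0, and at n = 0
   both P_{n-1} terms (written with n.-1) have a zero factor n%:R, so the
   totalised values used there are irrelevant. *)
Theorem mainTheorem3 (R : realType) (N : nat) (alpha beta : R)
  (Hwd : forall m k : nat, (k <= m)%N -> (m <= N)%N ->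
           pochhammer (1 - beta - m%:R) k != 0)
  (n : nat) (hn : (n <= N)%N) (x : nat) (hx : (x <= N)%N) :
  recA N beta n * Pn N alpha beta n.+1 x%:R
  - (recA N beta n + recB alpha beta n) * Pn N alpha beta n x%:R
  + recB alpha beta n * Pn N alpha beta n.-1 x%:R
  = - x%:R * ((n%:R + alpha + 1) * Pn N alpha beta n x%:R
      + n%:R * (alpha + beta + n%:R) / (1 - beta - n%:R)
        * Pn N alpha beta n.-1 x%:R).
Proof.
set c := _ / _.
pose e k := (n%:R + alpha + 1) * gridCoef alpha beta n k
  + c * gridCoef alpha beta n.-1 k.
rewrite (@PnE _ N _ _ n.+1 n.+2) // (@PnE _ N _ _ n n.+2) //.
rewrite (@PnE _ N _ _ n.-1 n.+2) ?(leq_ltn_trans (leq_pred n)) //.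
have -> : (n%:R + alpha + 1)
    * (\sum_(k < n.+2) gridCoef alpha beta n k * gridBasis N x%:R k)
  + c * (\sum_(k < n.+2) gridCoef alpha beta n.-1 k * gridBasis N x%:R k)
  = \sum_(k < n.+2) e k * gridBasis N x%:R k.
  rewrite !mulr_sumr -big_split; apply: eq_bigr => k _ /=.
  by rewrite /e; ring.
(* The bracket has degree at most n, so multiplying by x stays within the range. *)
have e_last : e n.+1 = 0.
  by rewrite /e !gridCoef_eq0 ?ltnS ?leq_pred // !mulr0 addr0.
have -> : - x%:R * (\sum_(k < n.+2) e k * gridBasis N x%:R k)
  = \sum_(k < n.+2) - k%:R * e k * gridBasis N x%:R k
    + \sum_(k < n.+1) k.+1%:R * (k%:R - N%:R) * e k * gridBasis N x%:R k.+1.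
  rewrite mulr_sumr big_ord_recr [X in _ = X + _]big_ord_recr /= e_last.
  rewrite !(mul0r, mulr0) !addr0 -big_split; apply: eq_bigr => k _ /=.
  by rewrite mulrCA mulNx_gridBasis //; ring.
(* The psi_0 terms split off: d_(n,0) = 1 for every n, so the left gives A - (A+B) + B = 0, and the
   right has the factor k = 0. *)
rewrite !mulr_sumr -sumrB -big_split /= big_ord_recl [in RHS]big_ord_recl /=.
rewrite !gridCoef0 oppr0 !mul0r add0r -big_split /=.
have cst0 (a b y : R) : a * (1 * y) - (a + b) * (1 * y) + b * (1 * y) = 0.
  by ring.
rewrite cst0 add0r; apply: eq_bigr => k _; rewrite /bump leq0n add1n.
have := gridCoef_recurrence _ _ _ _ Hwd n k hn.
rewrite /= -/c -!/(e _) => H.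
by rewrite -[RHS]mulrDl -H; [ring | rewrite -ltnS].
Qed.
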